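(* Let $n\ge2$, let $\mathcal{S}=\{\sum_{i=1}^{n+1}a_ix_i=d\}\cap\mathbb{S}^n$ be an $(n-1)$-sphere in $\mathbb{S}^n$, and let $$\mathcal{C}(\mathcal{S})=\Big\{(x_1,\ldots,x_{n+1})\in\mathbb{R}^{n+1} : \Big(\sum_{i=1}^{n+1}a_ix_i\Big)^2-d^2\sum_{i=1}^{n+1}x_i^2=0\Big\}$$ be the cone on $\mathcal{S}$. Suppose that $\chi$ is a homogeneous polynomial vector field on $\mathbb{S}^n$. Then the set $\mathcal{S}$ is invariant for $\chi$ if and only if the set $\mathcal{C}(\mathcal{S})$ is invariant for $\chi$.
   Context: $\mathbb{S}^n=\{x\in\mathbb{R}^{n+1} : \sum_i x_i^2=1\}$. A polynomial vector field $\chi=(P_1,\ldots,P_{n+1})$ in $\mathbb{R}^{n+1}$ is identified with the operator $\sum_i P_i\,\partial/\partial x_i$; it is homogeneous if the $P_i$ are homogeneous polynomials of the same degree. It is a vector field on $\mathbb{S}^n$ if $\chi(\sum_i x_i^2-1)=K(\sum_i x_i^2-1)$ for some real polynomial $K$. A subset of $\mathbb{R}^{n+1}$ is invariant for $\chi$ if it is a union of trajectories of $\chi$. An $(n-1)$-sphere in $\mathbb{S}^n$ is an intersection $\{\sum_i a_ix_i=d\}\cap\mathbb{S}^n$ with $a_i,d\in\mathbb{R}$, $\sum_i a_i^2=1$, $|d|<1$. *)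

(* Defs.v *)
From HB Require Import structures.
From mathcomp Require Import all_boot all_order all_algebra.
From mathcomp Require Import all_classical all_reals all_analysis.
(* The notations of mpoly clash with those of MathComp-Analysis. *)
From mathcomp Require Import -(notations) mpoly.

Set Implicit Arguments.
Unset Strict Implicit.
Unset Printing Implicit Defensive.

Import Order.TTheory GRing.Theory Num.Theory numFieldNormedType.Exports.

Local Open Scope classical_set_scope.
Local Open Scope ring_scope.

Definition sphere (R : realType) (n : nat) : set 'rV[R]_n.+1 :=
  [set x : 'rV[R]_n.+1 | \sum_(i < n.+1) x 0 i ^+ 2 = 1].

Definition subsphere (R : realType) (n : nat) (a : 'rV[R]_n.+1) (d : R) :
    set 'rV[R]_n.+1 :=
  [set x : 'rV[R]_n.+1 | \sum_(i < n.+1) a 0 i * x 0 i = d] `&` @sphere R n.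

Definition cone (R : realType) (n : nat) (a : 'rV[R]_n.+1) (d : R) :
    set 'rV[R]_n.+1 :=
  [set x : 'rV[R]_n.+1 | (\sum_(i < n.+1) a 0 i * x 0 i) ^+ 2
           - d ^+ 2 * (\sum_(i < n.+1) x 0 i ^+ 2) = 0].

Definition vfield (R : realType) (N : nat) := 'I_N -> mpoly N R.

Definition vfield_op (R : realType) (N : nat) (X : vfield R N)
    (f : mpoly N R) : mpoly N R :=
  \sum_(i < N) X i * mderiv i f.

Definition vfield_eval (R : realType) (N : nat) (X : vfield R N)
    (x : 'rV[R]_N) : 'rV[R]_N :=
  \row_(i < N) meval (fun j => x 0 j) (X i).

(* The zero polynomial is homogeneous of every degree. *)
Definition homogeneous_vfield (R : realType) (N : nat) (X : vfield R N) :
    Prop :=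
  exists m : nat, forall i : 'I_N, X i \is ishomog1 m (@mdeg N).

Definition sphere_poly (R : realType) (n : nat) : mpoly n.+1 R :=
  \sum_(i < n.+1) mpolyX R (mnm1 i) ^+ 2 - 1.

Definition vfield_on_sphere (R : realType) (n : nat) (X : vfield R n.+1) :
    Prop :=
  exists K : mpoly n.+1 R,
    vfield_op X (sphere_poly R n) = K * sphere_poly R n.

(* Values of c outside I are irrelevant; since I is open, is_derive only
   depends on the restriction of c to I. *)
Definition integral_curve (R : realType) (n : nat) (X : vfield R n.+1)
    (I : set R) (c : R -> 'rV[R]_n.+1) : Prop :=
  [/\ open I, is_interval I, I !=set0 &
      forall t, I t -> is_derive t 1 c (vfield_eval X (c t))].

Definition maximal_integral_curve (R : realType) (n : nat)
    (X : vfield R n.+1) (I : set R) (c : R -> 'rV[R]_n.+1) : Prop :=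
  integral_curve X I c /\
  forall (J : set R) (e : R -> 'rV[R]_n.+1),
    integral_curve X J e -> I `<=` J -> (forall t, I t -> e t = c t) -> J = I.

Definition trajectory (R : realType) (n : nat) (X : vfield R n.+1)
    (T : set 'rV[R]_n.+1) : Prop :=
  exists (I : set R) (c : R -> 'rV[R]_n.+1),
    maximal_integral_curve X I c /\ T = c @` I.

Definition invariant_set (R : realType) (n : nat) (X : vfield R n.+1)
    (A : set 'rV[R]_n.+1) : Prop :=
  exists F : set (set 'rV[R]_n.+1),
    F `<=` trajectory X /\ A = \bigcup_(T in F) T.

(* Main.v *)
Require Import Defs.
From HB Require Import structures.
From mathcomp Require Import all_boot all_order all_algebra.
From mathcomp Require Import all_classical all_reals all_analysis.
From mathcomp Require Import -(notations) mpoly.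
From mathcomp Require Import ring lra.

Set Implicit Arguments.
Unset Strict Implicit.
Unset Printing Implicit Defensive.

Import Order.TTheory GRing.Theory Num.Theory numFieldNormedType.Exports.

Local Open Scope classical_set_scope.
Local Open Scope ring_scope.

(** The field [X] is everywhere orthogonal to the position vector
    ([vfield_orthogonal]): on the unit sphere this is what tangency says, and
    homogeneity carries it to every other sphere about the origin.  Hence the
    Euclidean norm is constant along every integral curve.

    The cone is the set of all real multiples of points of the subsphere
    ([cone_scale], [subsphere_cone], [cone_normalize]), and a homogeneous field
    of degree [m] is compatible with scaling: if [c] is an integral curve, so
    is [l c(k t)] with [k = l^(m-1)].  This change of variables is invertible
    for [l != 0], so it preserves maximality and maps trajectories to
    trajectories ([trajectory_scale]).

    If the subsphere is invariant, a nonzero point of the cone is [r y] with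
    [y] in the subsphere, and [r] times the trajectory of [y] stays in the
    cone; the origin is an equilibrium ([vfield_eval0]), so it is a trajectory
    by itself.  If the cone is invariant, a point of the subsphere lies on a
    trajectory inside the cone.  Along it the norm remains [1], so the linear
    form [a . x] has square [d^2] throughout; being continuous on an interval
    it cannot jump between [d] and [-d], and it keeps the value [d]. *)

(** * Derivatives of curves on an interval *)

Lemma is_derive_rowP (R : realType) (n : nat) (c : R -> 'rV[R]_n) (t : R)
    (v : 'rV[R]_n) :
  is_derive t 1 c v <-> forall i, is_derive t 1 (fun s => c s 0 i) (v 0 i).
Proof.
split=> [[dc <-] i | dc].
  have dci := (derivable_mxP c t 1).1 dc 0 i.
  by apply: (DeriveDef dci); rewrite derive_mx // mxE.
have dc' : derivable c t 1.
  by apply/derivable_mxP => i j; rewrite ord1; have [] := dc j.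
apply: (DeriveDef dc'); rewrite derive_mx //; apply/matrixP => i j.
by rewrite ord1 mxE; have [_ ->] := dc j.
Qed.

Lemma is_derive_sum_pointwise (R : realType) (n : nat) (h : 'I_n -> R -> R)
    (t : R) (dh : 'I_n -> R) :
  (forall i, is_derive t 1 (h i) (dh i)) ->
  is_derive t 1 (fun s => \sum_(i < n) h i s) (\sum_(i < n) dh i).
Proof. by move=> /is_derive_sum; rewrite fct_sumE. Qed.

Lemma is_derive_within_continuous (R : realType) (I : set R) (f df : R -> R)
    (s t : R) :
  is_interval I -> I s -> I t -> (forall u, I u -> is_derive u 1 f (df u)) ->
  {within `[s, t], continuous f}.
Proof.
move=> itvI Is It df_; apply: derivable_within_continuous => u.
by rewrite in_itv /= => /(itvI _ _ Is It)/df_[].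
Qed.

Lemma is_derive0_interval_cst (R : realType) (I : set R) (f : R -> R) :
  is_interval I -> (forall t, I t -> is_derive t 1 f 0) ->
  forall s t, I s -> I t -> f s = f t.
Proof.
move=> itvI df s t; wlog st : s t / s <= t.
  by move=> H Is It; case: (leP s t) => [/H -> //|/ltW/H ->].
move=> Is It; have cf := is_derive_within_continuous itvI Is It df.
have [|u _] := @MVT_segment R f (fun=> 0) s t st _ cf.
  by move=> u ust; apply/df/(itvI _ _ Is It)/andP; rewrite !ltW ?(itvP ust).
by rewrite mul0r => /eqP; rewrite subr_eq0 => /eqP.
Qed.

(** By the intermediate value theorem, passing from [d] to [- d] would force a
    zero of [f], hence [d = 0]. *)
Lemma sqr_cst_interval_cst (R : realType) (I : set R) (f df : R -> R) (d : R) :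
  is_interval I -> (forall t, I t -> is_derive t 1 f (df t)) ->
  (forall t, I t -> f t ^+ 2 = d ^+ 2) ->
  forall s t, I s -> I t -> f s = f t.
Proof.
move=> itvI df_ fd s t; wlog st : s t / s <= t.
  by move=> H Is It; case: (leP s t) => [/H -> //|/ltW/H ->].
move=> Is It; have cf := is_derive_within_continuous itvI Is It df_.
have /eqP : f s ^+ 2 = f t ^+ 2 by rewrite !fd.
rewrite eqf_sqr => /orP[/eqP //|/eqP fst].
have [|u ust fu0] := @IVT R f s t 0 st cf.
  rewrite fst ge_min le_max; case: (lerP 0 (f t)) => ?;
    by apply/andP; split; apply/orP; lra.
have Iu : I u by apply: (itvI _ _ Is It); move: ust; rewrite in_itv.
have d0 : d ^+ 2 = 0 by rewrite -(fd u Iu) fu0 expr0n.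
by have := fd _ Is; have := fd _ It; rewrite d0 => /eqP + /eqP;
  rewrite !sqrf_eq0 => /eqP -> /eqP ->.
Qed.

(** * Homogeneous fields tangent to the sphere *)

Lemma meval_homog (R : realType) (n m : nat) (p : mpoly n R) (l : R)
    (v : 'I_n -> R) :
  p \is ishomog1 m (@mdeg n) ->
  meval (fun i => l * v i) p = l ^+ m * meval v p.
Proof.
move=> /dhomogP hp; rewrite !mevalE big_distrr /=.
apply: eq_big_seq => w /hp <-; rewrite mulrCA; congr (_ * _).
rewrite [_ ^+ _ in RHS](_ : _ = \prod_i l ^+ w i); last first.
  by rewrite prodrXr -mdegE.
rewrite -big_split /=.
by apply: eq_bigr => i _; rewrite exprMn.
Qed.

Lemma vfield_eval_scale (R : realType) (n m : nat) (X : vfield R n) (l : R)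
    (x : 'rV[R]_n) :
  (forall i, X i \is ishomog1 m (@mdeg n)) ->
  vfield_eval X (l *: x) = l ^+ m *: vfield_eval X x.
Proof.
move=> hX; apply/rowP => i; rewrite !mxE -meval_homog //.
by congr meval; apply/funext => j; rewrite mxE.
Qed.

Lemma meval_sphere_poly (R : realType) (n : nat) (v : 'I_n.+1 -> R) :
  meval v (sphere_poly R n) = \sum_i v i ^+ 2 - 1.
Proof.
rewrite /sphere_poly mevalB rmorph_sum rmorph1; congr (_ - _).
by apply: eq_bigr => i _; rewrite rmorphXn /= mevalXU.
Qed.

Lemma mderiv_sphere_poly (R : realType) (n : nat) (i : 'I_n.+1) :
  mderiv i (sphere_poly R n) = mpolyX R (mnm1 i) *+ 2.
Proof.
rewrite /sphere_poly mderivB raddf_sum.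
have -> : mderiv i 1 = 0 :> mpoly n.+1 R by exact: mderivC.
have dX j : mderiv i (mpolyX R (mnm1 j)) = (i == j)%:R :> mpoly n.+1 R.
  rewrite mderivX mnm1E eq_sym; case: eqP => [->|_]; last by rewrite scale0r.
  rewrite scale1r -mpolyX0; congr mpolyX; apply/mnmP => k.
  by rewrite mnmBE subnn mnm0E.
rewrite subr0 (bigD1 i) //= big1 => [|j ji]; rewrite expr2 mderivM dX.
  by rewrite eqxx mul1r mulr1 addr0.
by rewrite eq_sym (negPf ji) mul0r mulr0 addr0.
Qed.

Lemma sum_sqr_eq0 (R : realType) (n : nat) (x : 'rV[R]_n) :
  \sum_i x 0 i ^+ 2 = 0 -> x = 0.
Proof.
move=> x0; apply/rowP => i; rewrite [RHS]mxE; apply/eqP; rewrite -sqrf_eq0.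
by apply/eqP/(psumr_eq0P _ x0) => // j _; exact: sqr_ge0.
Qed.

(** At a unit vector, evaluating the tangency identity annihilates its
    right-hand side, whatever the cofactor [K], and leaves twice the inner
    product.  A general nonzero [x] is [r] times a unit vector, which multiplies
    the inner product by [r ^+ m * r]. *)
Lemma vfield_orthogonal (R : realType) (n : nat) (X : vfield R n.+1) :
  homogeneous_vfield X -> vfield_on_sphere X ->
  forall x : 'rV[R]_n.+1, \sum_i vfield_eval X x 0 i * x 0 i = 0.
Proof.
move=> [m hX] [K hK].
have orth1 (u : 'rV[R]_n.+1) : \sum_i u 0 i ^+ 2 = 1 ->
    \sum_i vfield_eval X u 0 i * u 0 i = 0.
  move=> u1; have := congr1 (meval (fun j => u 0 j)) hK.
  rewrite mevalM meval_sphere_poly u1 subrr mulr0 /vfield_op rmorph_sum /=.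
  under eq_bigr do rewrite mevalM mderiv_sphere_poly rmorphMn /= mevalXU mulrnAr.
  rewrite sumrMnl => /eqP; rewrite mulrn_eq0 /= => /eqP s0.
  rewrite -[RHS]s0.
  by apply: eq_bigr => i _; rewrite mxE.
move=> x; have s_ge0 : 0 <= \sum_i x 0 i ^+ 2.
  by apply: sumr_ge0 => i _; exact: sqr_ge0.
have [x0|xN0] := eqVneq (\sum_i x 0 i ^+ 2) 0.
  by rewrite (sum_sqr_eq0 x0) big1 // => i _; rewrite [X in _ * X]mxE mulr0.
set r := Num.sqrt (\sum_i x 0 i ^+ 2).
have r2 : r ^+ 2 = \sum_i x 0 i ^+ 2 by rewrite sqr_sqrtr.
have r0 : r != 0 by rewrite -sqrf_eq0 r2.
have -> : x = r *: (r^-1 *: x) by rewrite scalerA divff // scale1r.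
have u1 : \sum_i (r^-1 *: x) 0 i ^+ 2 = 1.
  under eq_bigr do rewrite mxE exprMn.
  by rewrite -big_distrr /= -r2 exprVn mulVf // sqrf_eq0.
rewrite (vfield_eval_scale _ _ hX).
under eq_bigr do rewrite mxE [X in _ * X]mxE mulrACA.
by rewrite -big_distrr /= orth1 // mulr0.
Qed.

(** * Quantities constant along integral curves *)

Lemma integral_curve_sqnorm_cst (R : realType) (n : nat) (X : vfield R n.+1)
    (I : set R) (c : R -> 'rV[R]_n.+1) :
  (forall x : 'rV[R]_n.+1, \sum_i vfield_eval X x 0 i * x 0 i = 0) ->
  integral_curve X I c ->
  forall s t, I s -> I t -> \sum_i c s 0 i ^+ 2 = \sum_i c t 0 i ^+ 2.
Proof.
move=> orth [_ itvI _ dc].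
apply: (is_derive0_interval_cst itvI (f := fun t => \sum_i c t 0 i ^+ 2)) => t It.
have dci := (is_derive_rowP _ _ _).1 (dc t It).
apply: is_derive_eq.
  by apply: is_derive_sum_pointwise => i; exact: is_deriveX 2 (dci i).
rewrite -[RHS](mulr0 2%:R) -[X in _ = _ * X](orth (c t)) big_distrr /=.
by apply: eq_bigr => i _; rewrite /GRing.scale /=; ring.
Qed.

Lemma integral_curve_linear_cst (R : realType) (n : nat) (X : vfield R n.+1)
    (I : set R) (c : R -> 'rV[R]_n.+1) (a : 'rV[R]_n.+1) (d : R) :
  integral_curve X I c ->
  (forall t, I t -> (\sum_i a 0 i * c t 0 i) ^+ 2 = d ^+ 2) ->
  forall s t, I s -> I t -> \sum_i a 0 i * c s 0 i = \sum_i a 0 i * c t 0 i.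
Proof.
move=> [_ itvI _ dc].
apply: (@sqr_cst_interval_cst R I (fun t => \sum_i a 0 i * c t 0 i)
  (fun t => \sum_i a 0 i * vfield_eval X (c t) 0 i) d itvI) => t It.
have dci := (is_derive_rowP _ _ _).1 (dc t It).
by apply: is_derive_sum_pointwise => i; exact: is_deriveZ (a 0 i) (dci i).
Qed.

(** * Trajectories under scaling *)

(** For [l != 0] the relation between [l] and [k] says [k = l^(m-1)], without a
    negative exponent when [m = 0].  A negative [k] reverses time. *)
Lemma integral_curve_scale (R : realType) (n m : nat) (X : vfield R n.+1)
    (I : set R) (c : R -> 'rV[R]_n.+1) (l k : R) :
  (forall i, X i \is ishomog1 m (@mdeg n.+1)) ->
  k != 0 -> l ^+ m = l * k -> integral_curve X I c ->
  integral_curve X [set t | I (k * t)] (fun t => l *: c (k * t)).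
Proof.
move=> hX k0 lk [oI itvI [t0 It0] dc]; split.
- by apply: (open_comp _ oI) => t _; exact: mulrl_continuous.
- move=> x y /= Ix Iy z /andP[xz zy].
  have [kp|kn|k00] := ltgtP 0 k; last by rewrite -k00 eqxx in k0.
  + by apply: (itvI _ _ Ix Iy); rewrite !ler_pM2l ?xz.
  + by apply: (itvI _ _ Iy Ix); rewrite !ler_nM2l ?xz ?zy.
- by exists (k^-1 * t0) => /=; rewrite mulrA divff // mul1r.
- move=> t /= It; apply/is_derive_rowP => i.
  have dci := (is_derive_rowP _ _ _).1 (dc _ It) i.
  have dk : is_derive t 1 ( *%R k) k.
    apply: (is_derive_eq (is_deriveZ k (is_derive_id t 1))).
    by rewrite /GRing.scale /= mulr1.
  have dl := is_deriveZ l (is_derive1_comp dci dk).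
  rewrite (_ : (fun _ => _) = l \*: ((fun s => c s 0 i) \o *%R k)); last first.
    by apply/funext => s; rewrite mxE.
  apply: (is_derive_eq dl).
  by rewrite (vfield_eval_scale _ _ hX) lk !mxE /GRing.scale /= mulrAC mulrA.
Qed.

(** An extension of the scaled curve, scaled back by [l^-1] and [k^-1], extends
    the original curve, so it cannot be proper. *)
Lemma maximal_integral_curve_scale (R : realType) (n m : nat)
    (X : vfield R n.+1) (I : set R) (c : R -> 'rV[R]_n.+1) (l k : R) :
  (forall i, X i \is ishomog1 m (@mdeg n.+1)) ->
  l != 0 -> k != 0 -> l ^+ m = l * k -> maximal_integral_curve X I c ->
  maximal_integral_curve X [set t | I (k * t)] (fun t => l *: c (k * t)).
Proof.
move=> hX l0 k0 lk [ic maxc]; split; first exact: integral_curve_scale hX _ _ _.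
move=> J e ie sub ext.
have kV0 : k^-1 != 0 by rewrite invr_eq0.
have lkV : l^-1 ^+ m = l^-1 * k^-1 by rewrite exprVn lk invfM.
have ie' := integral_curve_scale hX kV0 lkV ie.
have JI : [set t | J (k^-1 * t)] = I.
  apply: (maxc _ _ ie') => [t It|t It] /=; first by apply: sub; rewrite /= mulVKf.
  by rewrite ext /= mulVKf // scalerA mulVf // scale1r.
by rewrite -JI; apply/seteqP; split => t /=; rewrite mulKf.
Qed.

Lemma trajectory_scale (R : realType) (n : nat) (X : vfield R n.+1)
    (T : set 'rV[R]_n.+1) (l : R) :
  homogeneous_vfield X -> l != 0 -> trajectory X T ->
  trajectory X (GRing.scale l @` T).
Proof.
move=> [m hX] l0 [I [c [mc ->]]].
set k := l ^+ m / l.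
have k0 : k != 0 by rewrite mulf_neq0 ?invr_eq0 ?expf_neq0.
have lk : l ^+ m = l * k by rewrite mulrCA divff // mulr1.
exists [set t | I (k * t)], (fun t => l *: c (k * t)).
split; first exact: maximal_integral_curve_scale hX l0 k0 lk mc.
apply/seteqP; split => [_ [_ [t It <-] <-]|_ [t /= It <-]].
  by exists (k^-1 * t); rewrite /= mulVKf.
by exists (c (k * t)) => //; exists (k * t).
Qed.

Lemma trajectory_equilibrium (R : realType) (n : nat) (X : vfield R n.+1)
    (x : 'rV[R]_n.+1) :
  vfield_eval X x = 0 -> trajectory X [set x].
Proof.
move=> Xx; exists setT, (fun=> x); split; last first.
  by apply/seteqP; split => [_ ->|_ [_ _ <-]] //; exists 0.
split; last by move=> J e _ TJ _; apply/seteqP; split.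
split; [exact: openT | by [] | by exists 0 |].
by move=> t _; rewrite Xx; exact: is_derive_cst.
Qed.

(** Put [u = X(0)].  Since [0 = 0 *: u], homogeneity gives [u = 0 ^+ m *: X(u)],
    and [X(u)] is orthogonal to [u], so [u . u = 0].  This treats a constant
    field ([m = 0]) together with the others. *)
Lemma vfield_eval0 (R : realType) (n : nat) (X : vfield R n.+1) :
  homogeneous_vfield X ->
  (forall x : 'rV[R]_n.+1, \sum_i vfield_eval X x 0 i * x 0 i = 0) ->
  vfield_eval X 0 = 0.
Proof.
move=> [m hX] orth; set u := vfield_eval X 0.
have uE : u = 0 ^+ m *: vfield_eval X u.
  by rewrite -(vfield_eval_scale _ _ hX) scale0r.
apply: sum_sqr_eq0.
rewrite -[RHS](mulr0 (0 ^+ m)) -[X in _ = _ * X](orth u) big_distrr /=.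
by apply: eq_bigr => i _; rewrite expr2 {1}uE mxE mulrA.
Qed.

(** * The cone and the subsphere *)

(** Turns the existence of one family of trajectories covering [A] into a
    condition on each point of [A]. *)
Lemma invariant_setP (R : realType) (n : nat) (X : vfield R n.+1)
    (A : set 'rV[R]_n.+1) :
  invariant_set X A <->
  forall x, A x -> exists T, [/\ trajectory X T, T x & T `<=` A].
Proof.
split=> [[F [FX ->]] x [T FT Tx]|H].
  by exists T; split=> //; [exact: FX | exact: bigcup_sup].
exists [set T | trajectory X T /\ T `<=` A]; split; first by move=> T [].
apply/seteqP; split => [x /H[T [? ? ?]]|x [T [_ TA] /TA //]].
by exists T.
Qed.

Lemma cone_scale (R : realType) (n : nat) (a : 'rV[R]_n.+1) (d l : R)
    (x : 'rV[R]_n.+1) :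
  cone a d x -> cone a d (l *: x).
Proof.
rewrite /cone /= => hx.
rewrite -[RHS](mulr0 (l ^+ 2)) -[X in _ = _ * X]hx mulrBr [l ^+ 2 * (d ^+ 2 * _)]mulrCA.
congr (_ - _ * _); last first.
  by rewrite big_distrr; apply: eq_bigr => i _; rewrite mxE exprMn.
rewrite -exprMn big_distrr; congr (_ ^+ 2).
by apply: eq_bigr => i _; rewrite mxE mulrCA.
Qed.

Lemma subsphere_cone (R : realType) (n : nat) (a : 'rV[R]_n.+1) (d : R) :
  subsphere a d `<=` cone a d.
Proof. by move=> x [/= hd hs]; rewrite /cone /= hd hs mulr1 subrr. Qed.

(** The sign of [r] is the point: [a . x] is [d |x|] or [- d |x|], and in the
    second case [r = - |x|] brings [x] back to the subsphere of [d] rather than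
    to the one of [- d]. *)
Lemma cone_normalize (R : realType) (n : nat) (a : 'rV[R]_n.+1) (d : R)
    (x : 'rV[R]_n.+1) :
  cone a d x -> x != 0 ->
  exists2 r, r != 0 & subsphere a d (r^-1 *: x).
Proof.
rewrite /cone /= => hx x0; set s := \sum_i x 0 i ^+ 2 in hx *.
have s_ge0 : 0 <= s by apply: sumr_ge0 => i _; exact: sqr_ge0.
have s0 : s != 0.
  by apply: contra x0 => /eqP s0; apply/eqP/sum_sqr_eq0.
have [r r2 rd] : exists2 r, r ^+ 2 = s & \sum_i a 0 i * x 0 i = d * r.
  move/eqP: hx; rewrite subr_eq0 -(sqr_sqrtr s_ge0) -exprMn eqf_sqr.
  case/orP => /eqP ->; first by exists (Num.sqrt s); rewrite ?sqr_sqrtr.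
  by exists (- Num.sqrt s); rewrite ?sqrrN ?sqr_sqrtr ?mulrN.
have r0 : r != 0 by rewrite -sqrf_eq0 r2.
exists r => //; split; rewrite /sphere /=.
  under eq_bigr do rewrite mxE mulrCA.
  by rewrite -big_distrr /= rd mulrCA mulVf // mulr1.
under eq_bigr do rewrite mxE exprMn.
by rewrite -big_distrr /= -/s -r2 exprVn mulVf // sqrf_eq0.
Qed.

Theorem lemma5p2 (R : realType) (n : nat) (hn : (2 <= n)%N)
    (a : 'rV[R]_n.+1) (d : R)
    (ha : \sum_(i < n.+1) a 0 i ^+ 2 = 1) (hd : `|d| < 1)
    (X : vfield R n.+1)
    (hX : homogeneous_vfield X) (hS : vfield_on_sphere X) :
  invariant_set X (subsphere a d) <-> invariant_set X (cone a d).
Proof.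
have orth := vfield_orthogonal hX hS.
rewrite !invariant_setP; split=> inv x Ax.
  have [->|x0] := eqVneq x 0.
    exists [set 0]; split=> //; first exact/trajectory_equilibrium/vfield_eval0.
    by move=> _ ->; rewrite -(scale0r x); exact: cone_scale.
  have [r r0 Srx] := cone_normalize Ax x0.
  have [T [trT Tx TS]] := inv _ Srx.
  exists (GRing.scale r @` T); split; first exact: trajectory_scale.
    by exists (r^-1 *: x) => //; rewrite scalerA divff // scale1r.
  by move=> _ [y /TS/subsphere_cone Cy <-]; exact: cone_scale.
have [T [trT Tx TC]] := inv _ (subsphere_cone Ax).
exists T; split=> //; case: trT Tx TC => I [c [[ic _] ->]] [t0 It0 xE] TC.
move: Ax; rewrite -{}xE => -[/= cd c1].
have sph t : I t -> \sum_i c t 0 i ^+ 2 = 1.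
  by move=> It; rewrite (integral_curve_sqnorm_cst orth ic It It0).
have lin2 t : I t -> (\sum_i a 0 i * c t 0 i) ^+ 2 = d ^+ 2.
  move=> It; have /eqP := TC _ (imageP c It).
  by rewrite sph // mulr1 subr_eq0 => /eqP.
move=> _ [t It <-]; split; last exact: sph.
by rewrite /= (integral_curve_linear_cst ic lin2 It It0).
Qed.
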